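(* Let $B>0$, $\mathcal Y=[-B,B]$, let $d,n\ge1$ be integers, let $q$ satisfy $1\le q\le1+\sqrt{\frac{\lfloor\log_2d\rfloor}{4n}\wedge1}$, and consider the loss $\ell(y,y')=|y-y'|^q$. For any input space $\mathcal X$ containing at least $\lfloor\log_2d\rfloor$ points, there exists a set $\mathcal G$ of $d$ prediction functions such that: for any estimator $\hat g$ (with training set size $n$) there exists a probability distribution on the data space $\mathcal X\times[-B,B]$ for which $$\mathbb ER(\hat g)-\min_{g\in\mathcal G}R(g)\ge\begin{cases}c_qB^q\sqrt{\frac{\lfloor\log_2|\mathcal G|\rfloor}n}&\text{if }|\mathcal G|<2^{4n+1},\\ 2c_qB^q&\text{otherwise,}\end{cases}$$ where $c_q=1/4$ if $q=1$ and $c_q=q/40$ if $1<q\le1+\sqrt{\frac{\lfloor\log_2|\mathcal G|\rfloor}{4n}\wedge1}$.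
   Context: A prediction function is a measurable map $\mathcal X\to\mathcal Y$. For a distribution $P$ on $\mathcal X\times\mathcal Y$, $R(g)=\mathbb E_{(X,Y)\sim P}\ell[Y,g(X)]$. An estimator maps a training set $Z_1^n\in(\mathcal X\times\mathcal Y)^n$ to a prediction function (measurably), and $\mathbb ER(\hat g)$ is its expected risk when $Z_1^n\sim P^{\otimes n}$. $a\wedge b=\min(a,b)$ and $\lfloor x\rfloor$ is the largest integer $k\le x$.
   Formalization: The input space is taken nonempty, and its ⌊log₂ d⌋ points are required to be pairwise separated by measurable sets; with a trivial sigma-algebra all prediction functions are constant and the claimed bound fails for large n and d. *)

(* Defs.v *)
From HB Require Import structures.
From mathcomp Require Import all_boot all_order all_algebra finmap.
From mathcomp Require Import all_classical all_reals all_analysis.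
Set Implicit Arguments.
Unset Strict Implicit.
Unset Printing Implicit Defensive.
Import Order.TTheory GRing.Theory Num.Theory.
Import numFieldNormedType.Exports.
Local Open Scope classical_set_scope.
Local Open Scope ring_scope.

(* The output space [-B, B], with the trace of the Borel sigma-algebra of R. *)
Definition label (R : realType) (B : {posnum R}) : Type :=
  {y : R | - B%:num <= y <= B%:num}.

Section label.
Context {R : realType} (B : {posnum R}).

HB.instance Definition _ := Choice.on (label B).

Definition label_val (y : label B) : R := val y.

Let label0 : - B%:num <= (0 : R) <= B%:num.
Proof. by rewrite oppr_le0 !ge0. Qed.

HB.instance Definition _ := isPointed.Build (label B) (exist _ 0 label0).

HB.instance Definition _ := @isMeasurable.Build (preimage_display label_val)
  (label B) (g_sigma_algebra_preimage label_val)
  (@measurable0 _ (g_sigma_algebra_preimageType label_val))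
  (@measurableC _ (g_sigma_algebra_preimageType label_val))
  (@bigcupT_measurable _ (g_sigma_algebra_preimageType label_val)).

Lemma measurable_label_val : measurable_fun [set: label B] label_val.
Proof. by move=> _ A mA; exists A. Qed.

End label.

(* "X has at least m points".  Points are counted up to indistinguishability by the sigma-algebra: without
   separation (e.g. on a trivial sigma-algebra, where every measurable function
   is constant) the cardinality of X says nothing about prediction functions. *)
Definition contains_points d (X : measurableType d) (m : nat) : Prop :=
  exists x : 'I_m -> X, forall i j : 'I_m, i != j ->
    exists A : set X, [/\ measurable A, A (x i) & ~ A (x j)].

Lemma contains_points_inj d (X : measurableType d) (m : nat) :
  (forall a : X, measurable [set a]) ->
  (exists x : 'I_m -> X, injective x) -> contains_points X m.
Proof.
move=> m1 [x xI]; exists x => i j ij; exists [set x i]; split => //=.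
by move=> /xI /esym /eqP; apply/negP.
Qed.

Section product_power.
Context {d} {T : measurableType d} {R : realType}.

Definition tuple_cons n (x : T * n.-tuple T) : n.+1.-tuple T :=
  [tuple of x.1 :: x.2].

Lemma measurable_tuple_cons n :
  measurable_fun [set: T * n.-tuple T] (@tuple_cons n).
Proof.
exact: (@measurable_cons _ _ (T * n.-tuple T)%type T fst n snd
  measurable_fst measurable_snd).
Qed.

HB.instance Definition _ n := isMeasurableFun.Build _ _ _ _ (@tuple_cons n)
  (@measurable_tuple_cons n).

Fixpoint power_probability (P : probability T R) (n : nat) :
    probability (n.-tuple T) R :=
  match n with
  | 0 => \d_([tuple] : 0.-tuple T)
  | k.+1 => distribution (P \x power_probability P k)%E (@tuple_cons k)
  end.

Lemma power_probabilityE (P : probability T R) (n : nat) (A : 'I_n -> set T) :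
  (forall i, measurable (A i)) ->
  power_probability P n [set t | forall i, A i (tnth t i)] =
  (\prod_(i < n) P (A i))%E.
Proof.
elim: n A => [|n IH] A mA.
  rewrite big_ord0 /= diracE mem_set // => -[] //.
have mS k (C : 'I_k -> set T) : (forall i, measurable (C i)) ->
    measurable [set t : k.-tuple T | forall i, C i (tnth t i)].
  move=> mC; rewrite [X in measurable X](_ : _ =
    \bigcap_(i in [set: 'I_k]) ((@tnth k T)^~ i @^-1` C i)).
    apply: fin_bigcap_measurable => [|i _]; first exact: finite_finset.
    by rewrite -[X in measurable X]setTI; exact: measurable_tnth.
  by apply/seteqP; split => t /= tC i; [move=> _; exact: tC|exact: (tC i I)].
rewrite /= /distribution /pushforward big_ord_recl -(IH (fun i => A (lift ord0 i))) //.
rewrite -(@product_measure1E _ _ _ _ _ P (power_probability P n)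
  (A ord0) [set t | forall i, A (lift ord0 i) (tnth t i)]) //; last first.
  exact: (mS n (fun i => A (lift ord0 i))).
congr (product_measure1 _ _ _); apply/seteqP; split => -[a t] /=.
  move=> At; split; first by have := At ord0; rewrite tnth0.
  by move=> i; have := At (lift ord0 i); rewrite tnthS.
move=> [Aa At] i; case: (unliftP ord0 i) => [j|] ->; last by rewrite tnth0.
by rewrite tnthS.
Qed.

End product_power.

Section risk.
Context {d} {X : measurableType d} {R : realType} {B : {posnum R}}.

Definition loss (q : R) (y y' : label B) : R :=
  `|label_val y - label_val y'| `^ q.

Definition risk (q : R) (P : probability (X * label B)%type R)
    (g : X -> label B) : \bar R :=
  (\int[P]_z (loss q z.2 (g z.1))%:E)%E.

(* Joint measurability in (z, x) makes z |-> risk q P (ghat z) measurable for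
   every P; prediction functions are the elements of {mfun X >-> label B}. *)
Definition estimator (n : nat)
    (ghat : n.-tuple (X * label B)%type -> {mfun X >-> label B}) : Prop :=
  measurable_fun [set: n.-tuple (X * label B)%type * X]
    (fun zx => ghat zx.1 zx.2).

Definition expected_risk (q : R) (P : probability (X * label B)%type R)
    (n : nat) (ghat : n.-tuple (X * label B)%type -> {mfun X >-> label B}) :
    \bar R :=
  (\int[power_probability P n]_z risk q P (ghat z))%E.

Definition min_risk (q : R) (P : probability (X * label B)%type R)
    (G : {fset {mfun X >-> label B}}) : \bar R :=
  \big[Order.min/+oo%E]_(g <- G) risk q P g.

End risk.

Section bound.
Context {R : realType}.

Definition cq (q : R) : R := if q == 1 then 1 / 4 else q / 40.

(* N stands for the cardinality of the class G. *)
Definition lower_bound (q B : R) (n N : nat) : R :=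
  if (N < 2 ^ (4 * n + 1))%N
  then cq q * B `^ q * Num.sqrt ((trunc_log 2 N)%:R / n%:R)
  else 2 * cq q * B `^ q.

End bound.

(* Main.v *)
Require Import Defs.
From HB Require Import structures.
From mathcomp Require Import all_boot all_order all_algebra finmap.
From mathcomp Require Import all_classical all_reals all_analysis.
From mathcomp Require Import measurable_realfun.
From mathcomp Require Import zify ring lra.
Import Order.TTheory GRing.Theory Num.Theory.
Import numFieldNormedType.Exports.
Local Open Scope classical_set_scope.
Local Open Scope ring_scope.

(* Assouad's argument on a hypercube of distributions.  Let k be the minimum of
   m = floor(log2 d) and 4n, and x = sqrt(k / 4n).  Put mass 1/k on each of k
   separated points, where the label is B or -B with probabilities (1 + x) / 2
   and (1 - x) / 2, the likelier sign being s_j at the j-th point.  Flipping one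
   s_j leaves two laws of the sample whose affinity (the sum of the pointwise
   minimum) is at least 1/2, while the excess risks of one prediction y under the
   two signs add up to at least 2 B^q (1 - I) / k, where I is the infimum of the
   normalized noisy risk of a single point.  Averaging over s gives an excess over
   B^q I of at least B^q (1 - I) / 2 for some s, whereas predicting s_j h B at
   every point, with h nearly optimal, costs at most slightly more than B^q I.
   Everything is supported on finitely many atoms, so all integrals are finite
   sums. *)

(** * Sums over tuples *)

Lemma sum_tuple_cons (V : nmodType) (C : finType) n (F : n.+1.-tuple C -> V) :
  \sum_t F t = \sum_c \sum_(t : n.-tuple C) F [tuple of c :: t].
Proof.
rewrite pair_big /= (reindex (fun p : C * n.-tuple C => [tuple of p.1 :: p.2])) //=.
exists (fun t => (thead t, [tuple of behead t])) => [[c t] _|t _] /=.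
  by congr pair; apply: val_inj.
by rewrite -tuple_eta.
Qed.

Lemma sum_tuple_prod (R : comPzSemiRingType) (C : finType) n (F : C -> R) :
  \sum_(t : n.-tuple C) \prod_(c <- t) F c = (\sum_c F c) ^+ n.
Proof.
elim: n => [|n IH].
  rewrite (big_pred1 ([tuple] : 0.-tuple C)) ?big_nil // => t /=.
  by apply/esym/eqP; exact: tuple0.
rewrite sum_tuple_cons exprS mulr_suml; apply: eq_bigr => c _.
by rewrite -IH mulr_sumr; apply: eq_bigr => t _; rewrite big_cons.
Qed.

(** * Finitely supported distributions and their powers *)

Section finite_mixture.
Context (R : realType) disp (T : measurableType disp) (C : finType)
  (pt : C -> T) (w : C -> R) (c0 : C).
Hypotheses (w0 : forall c, 0 <= w c) (w1 : \sum_c w c = 1).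

(** [msum] is indexed by naturals, hence this enumeration of the atoms; the default [c0] is never
    reached for [i < #|C|]. *)
Let e i := nth c0 (enum C) i.

Let sum_e (F : C -> R) : \sum_(i < #|C|) F (e i) = \sum_c F c.
Proof. by rewrite -[RHS]big_enum (big_nth c0) -cardE big_mkord. Qed.

Let summand i : measure T R := mscale (NngNum (w0 (e i))) (dirac (pt (e i))).

Definition finite_mixture : set T -> \bar R := msum summand #|C|.

HB.instance Definition _ := Measure.on finite_mixture.

Let finite_mixture_setT : finite_mixture setT = 1%E.
Proof.
rewrite /finite_mixture /msum (eq_bigr (fun i : 'I__ => (w (e i))%:E)) => [|i _].
  by rewrite sumEFin sum_e w1.
by rewrite -[RHS]mule1; congr (_ * _)%E; exact: diracT.
Qed.

HB.instance Definition _ :=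
  Measure_isProbability.Build _ _ _ finite_mixture finite_mixture_setT.

Lemma exists_finite_mixture :
  exists P : probability T R, forall f : T -> R, (forall x, 0 <= f x) ->
    measurable_fun [set: T] f ->
    (\int[P]_x (f x)%:E = (\sum_c w c * f (pt c))%:E)%E.
Proof.
exists finite_mixture => f f0 mf.
have /measurable_EFinP mfE := mf.
rewrite [LHS](@ge0_integral_measure_sum _ _ _ _ setT _ (EFin \o f)) //=; last first.
  by move=> x _; rewrite lee_fin.
rewrite -sum_e -sumEFin; apply: eq_bigr => i _.
rewrite ge0_integral_mscale //=; last by move=> x _; rewrite lee_fin.
by rewrite integral_dirac // diracT mul1e EFinM.
Qed.

End finite_mixture.

(** Induction on [n]: Tonelli integrates out the tail of the tuple first, then the head is summed
    over the atoms of [P]. *)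
Lemma integral_power_probability (R : realType) disp (T : measurableType disp)
    (C : finType) (pt : C -> T) (w : C -> R) (P : probability T R) :
    (forall c, 0 <= w c) ->
    (forall f : T -> R, (forall x, 0 <= f x) -> measurable_fun [set: T] f ->
      (\int[P]_x (f x)%:E = (\sum_c w c * f (pt c))%:E)%E) ->
  forall n (f : n.-tuple T -> R), (forall x, 0 <= f x) ->
    measurable_fun [set: n.-tuple T] f ->
    (\int[power_probability P n]_x (f x)%:E =
      (\sum_(t : n.-tuple C) (\prod_(c <- t) w c) * f (map_tuple pt t))%:E)%E.
Proof.
move=> w0 intP; elim=> [|n IH] f f0 mf.
  rewrite /= integral_dirac //; last exact/measurable_EFinP.
  rewrite diracT mul1e (big_pred1 ([tuple] : 0.-tuple C)); last first.
    by move=> t /=; apply/esym/eqP; exact: tuple0.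
  by rewrite big_nil mul1r; congr (f _)%:E; apply: val_inj.
have /measurable_EFinP mfE := mf.
rewrite [LHS](ge0_integral_distribution _ mfE) /= => [|y]; last first.
  by rewrite lee_fin.
have mfc := measurableT_comp mf (@measurable_tuple_cons _ T n).
rewrite fubini_tonelli1 /=; last 2 first.
- exact/measurable_EFinP.
- by move=> y; rewrite lee_fin.
rewrite /fubini_F.
under eq_integral => x _.
  rewrite (IH (fun t => f (tuple_cons (x, t)))) //; last first.
    exact: (measurableT_comp mfc (measurable_pair1 x)).
  over.
rewrite intP => [|x|]; last 2 first.
- by apply: sumr_ge0 => t _; rewrite mulr_ge0 // big_seq prodr_ge0.
- apply: measurable_sum => t; apply: measurable_funM => //.
  exact: (measurableT_comp mfc (measurable_pair2 _)).
congr EFin; rewrite sum_tuple_cons; apply: eq_bigr => c _.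
rewrite mulr_sumr; apply: eq_bigr => t _; rewrite big_cons mulrA.
by congr (_ * f _); apply: val_inj.
Qed.

(** * Affinity of product distributions *)

(* With [u = a + b], [u * s * (4 * M - u) <= 4 * s * M ^+ 2 = 4 * a * b], so the
   bound follows from [2 * `|a - b| * u <= 2 * (a - b) ^+ 2 + u ^+ 2 / 2]. *)
Lemma dist_le_geometric_mean (R : realFieldType) (a b s M : R) :
    0 <= a -> 0 <= b -> 0 <= s -> a * b = s * M ^+ 2 ->
  `|a - b| <= 5 / 4 * (a + b) - s * (4 * M - (a + b)).
Proof.
move=> a0 b0 s0 ab.
have [u0|u0] := ltP 0 (a + b); last first.
  have [a_eq0 b_eq0] : a = 0 /\ b = 0 by split; lra.
  move: ab; rewrite a_eq0 b_eq0 mul0r => /esym /eqP.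
  rewrite mulf_eq0 expf_eq0 /= => /orP[/eqP ->|/eqP ->]; rewrite subrr normr0; nra.
rewrite -(ler_pM2r u0) mulrBl.
have d2 : `|a - b| ^+ 2 = (a - b) ^+ 2 by rewrite real_normK // num_real.
have h1 : `|a - b| * (a + b) <= (a - b) ^+ 2 + (a + b) ^+ 2 / 4.
  have := sqr_ge0 (`|a - b| - (a + b) / 2); rewrite -d2; nra.
have h2 : s * (4 * M - (a + b)) * (a + b) <= 4 * (a * b).
  by rewrite ab; have := mulr_ge0 s0 (sqr_ge0 (2 * M - (a + b))); nra.
nra.
Qed.

(** [S * D ^+ 2] is the product [A * B] of the two likelihoods, so a polynomial bound replaces the
    geometric mean, and each of its terms sums over tuples to an [n]-th power. The total is
    [(1 - e) ^+ n - 1 / 4], and Bernoulli's inequality gives [(1 - e) ^+ n >= 3 / 4]. *)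
Lemma affinity_ge_half (R : realFieldType) (C : finType) n (a b s M : C -> R) (e : R) :
    (forall c, 0 <= a c) -> (forall c, 0 <= b c) -> (forall c, 0 <= s c) ->
    (forall c, a c * b c = s c * M c ^+ 2) ->
    \sum_c a c = 1 -> \sum_c b c = 1 ->
    \sum_c s c * M c = 1 - e -> \sum_c s c * a c = 1 - e ->
    \sum_c s c * b c = 1 - e ->
    0 <= e <= 1 -> e *+ n <= 1 / 4 ->
  1 / 2 <= \sum_(t : n.-tuple C) Num.min (\prod_(c <- t) a c) (\prod_(c <- t) b c).
Proof.
move=> a0 b0 s0 abE a1 b1 sM sa sb /andP[e0 e1] en.
have bern : 3 / 4 <= (1 - e) ^+ n.
  have : 1 - e *+ n <= (1 - e) ^+ n.
    elim: (n) => [|k IH]; first by rewrite mulr0n expr0 subr0.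
    rewrite exprS mulrSr.
    have : 0 <= e * (e *+ k) by rewrite mulr_ge0 // mulrn_wge0.
    have := ler_wpM2l (_ : 0 <= 1 - e) IH; rewrite subr_ge0 => /(_ e1).
    set x := e *+ k; set y := _ ^+ k; nra.
  lra.
pose A (t : n.-tuple C) := \prod_(c <- t) a c.
pose B (t : n.-tuple C) := \prod_(c <- t) b c.
pose S (t : n.-tuple C) := \prod_(c <- t) s c.
pose D (t : n.-tuple C) := \prod_(c <- t) M c.
(* This is [min(A, B) = (A + B - |A - B|) / 2] combined with [dist_le_geometric_mean]. *)
have pw t : 2 * S t * D t - S t * A t / 2 - S t * B t / 2 - A t / 8 - B t / 8
    <= Num.min (A t) (B t).
  have abE_t : A t * B t = S t * D t ^+ 2.
    by rewrite -prodrXl -!big_split; apply: eq_bigr => c _; exact: abE.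
  have := @dist_le_geometric_mean _ (A t) (B t) (S t) (D t); rewrite !prodr_ge0 //.
  move=> /(_ isT isT isT abE_t).
  have := ler_norm (A t - B t); have := lerNnormlW (lexx `|A t - B t|).
  rewrite /Num.min; case: ltP => _; lra.
apply: le_trans (ler_sum _ (fun t _ => pw t)).
rewrite !sumrB -!mulr_suml.
rewrite (eq_bigr (fun t => 2 * (S t * D t))) => [|t _]; last by rewrite mulrA.
rewrite -mulr_sumr.
have sumM (F G : C -> R) :
    \sum_(t : n.-tuple C) \prod_(c <- t) F c * \prod_(c <- t) G c =
    (\sum_c F c * G c) ^+ n.
  by under eq_bigr do rewrite -big_split; exact: sum_tuple_prod.
by rewrite !sumM !sum_tuple_prod a1 b1 sM sa sb !expr1n; lra.
Qed.

(** * The hypercube of distributions and Assouad's lemma *)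

Definition cube_weight {R : fieldType} {m} (x : R) (s : 'I_m -> bool)
    (c : 'I_m * bool) : R :=
  (1 + (if c.2 == s c.1 then x else - x)) / 2 / m%:R.

Definition flip {m} (j : 'I_m) (s : {ffun 'I_m -> bool}) : {ffun 'I_m -> bool} :=
  [ffun i => (i == j) (+) s i].

Lemma flipK {m} (j : 'I_m) : involutive (flip j).
Proof. by move=> s; apply/ffunP => i; rewrite !ffunE addKb. Qed.

Lemma sum_cube {V : nmodType} {m} (F : 'I_m * bool -> V) (s : 'I_m -> bool) :
  \sum_c F c = \sum_j (F (j, s j) + F (j, ~~ s j)).
Proof.
rewrite (eq_bigr (fun c => F (c.1, c.2))) => [|[]//].
rewrite -(pair_bigA _ (fun j b => F (j, b))) /=; apply: eq_bigr => j _.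
by rewrite big_bool /=; case: (s j) => //=; rewrite addrC.
Qed.

Section cube.
Context (R : realFieldType) (m : nat) (x : R).
Hypotheses (m0 : (0 < m)%N) (x01 : 0 <= x <= 1).

Let m_neq0 : m%:R != 0 :> R.
Proof. by rewrite pnatr_eq0 -lt0n. Qed.

Lemma cube_weight_ge0 s c : 0 <= @cube_weight R m x s c.
Proof. by have /andP[? ?] := x01; rewrite !divr_ge0 //; case: ifP => _; lra. Qed.

Lemma sum_cube_weight s (F : 'I_m * bool -> R) :
  \sum_c cube_weight x s c * F c =
  (\sum_j ((1 + x) / 2 * F (j, s j) + (1 - x) / 2 * F (j, ~~ s j))) / m%:R.
Proof.
rewrite (sum_cube _ s) mulr_suml; apply: eq_bigr => j _.
by rewrite /cube_weight /= eqxx; case: (s j) => /=; field.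
Qed.

Lemma sum_cube_weight1 s : \sum_c @cube_weight R m x s c = 1.
Proof.
under eq_bigr do rewrite -[cube_weight _ _ _]mulr1.
rewrite sum_cube_weight (eq_bigr (fun=> 1)) => [|j _]; last by field.
by rewrite sumr_const card_ord divff.
Qed.

Lemma cube_affinity n (j : 'I_m) (s : {ffun 'I_m -> bool}) : x ^+ 2 * n%:R / m%:R <= 1 / 4 ->
  1 / 2 <= \sum_(t : n.-tuple ('I_m * bool))
    Num.min (\prod_(c <- t) cube_weight x s c)
            (\prod_(c <- t) cube_weight x (flip j s) c).
Proof.
move=> xn; have /andP[x_ge0 x_le1] := x01.
(* The two laws differ only at point [j], where their product is [(1 - x ^+ 2) * (1 / 2 / m) ^+ 2]
   for either label. The factor [S] lowers the mass of that point, [1 / m], by [x ^+ 2 / m], which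
   is the [e] of [affinity_ge_half]. *)
pose M (c : 'I_m * bool) : R :=
  if c.1 == j then 1 / 2 / m%:R else cube_weight x s c.
pose S (c : 'I_m * bool) : R := if c.1 == j then 1 - x ^+ 2 else 1.
have sumS (F : 'I_m * bool -> R) :
    (forall i, i != j -> F (i, s i) + F (i, ~~ s i) = 1 / m%:R) ->
    F (j, s j) + F (j, ~~ s j) = 1 / m%:R ->
    \sum_c S c * F c = 1 - x ^+ 2 / m%:R.
  move=> Fi Fj; rewrite (sum_cube _ s) (bigD1 j) //= /S /= eqxx -mulrDr Fj.
  rewrite (eq_bigr (fun=> 1 / m%:R)) => [|i ij]; last first.
    by rewrite (negbTE ij) !mul1r Fi // mul1r.
  have predE : m.-1%:R = m%:R - 1 :> R.
    by rewrite -[in RHS](prednK m0) -natr1 addrK.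
  by rewrite sumr_const cardC1 card_ord -[X in _ + X]mulr_natr predE; field.
apply: (@affinity_ge_half _ _ _ _ _ S M (x ^+ 2 / m%:R)).
- exact: cube_weight_ge0.
- exact: cube_weight_ge0.
- by move=> c; rewrite /S; case: ifP => _ //; nra.
- move=> [i b]; rewrite /S /M /cube_weight /= ffunE.
  have [->|ij] /= := eqVneq i j; last by rewrite mul1r expr2.
  by case: b (s j) => -[] /=; field.
- exact: sum_cube_weight1.
- exact: sum_cube_weight1.
- apply: sumS => [i /negbTE ij|]; rewrite /M /= ?ij ?eqxx; last by field.
  by rewrite /cube_weight /= eqxx; case: (s i) => /=; field.
- by apply: sumS => [i _|]; rewrite /cube_weight /= eqxx;
    case: (s _) => /=; field.
- by apply: sumS => [i /negbTE ij|]; rewrite /cube_weight /= ffunE ?ij ?eqxx;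
    case: (s _) => /=; field.
- have m1 : 1 <= m%:R :> R by rewrite ler1n.
  have mgt0 : 0 < m%:R :> R by lra.
  apply/andP; split; first by rewrite divr_ge0 ?sqr_ge0 // ltW.
  by rewrite ler_pdivrMr // mul1r (le_trans _ m1) // exprn_ile1.
- by rewrite -[X in X <= _]mulr_natr mulrAC.
Qed.

(** For fixed [j], pair [s] with [flip j s]: the two losses at [j] add up to at least [D], and both
    weights are at least their minimum, so the affinity bound gives [D / 2] per pair. Averaging over
    [s] and [j] gives [D / 4], and some [s] reaches the average. *)
Lemma assouad n (L : 'I_m -> bool -> n.-tuple ('I_m * bool) -> R) (D : R) :
    x ^+ 2 * n%:R / m%:R <= 1 / 4 ->
    0 <= D -> (forall j b t, 0 <= L j b t) ->
    (forall j t, D <= L j true t + L j false t) ->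
  exists s : 'I_m -> bool, D / 4 <= \sum_(t : n.-tuple ('I_m * bool))
    (\prod_(c <- t) cube_weight x s c) * ((\sum_j L j (s j) t) / m%:R).
Proof.
move=> xn D0 L0 LD.
pose W s (t : n.-tuple ('I_m * bool)) := \prod_(c <- t) @cube_weight R m x s c.
have W0 s t : 0 <= W s t by apply: prodr_ge0 => c _; exact: cube_weight_ge0.
pose G j (s : {ffun 'I_m -> bool}) := \sum_t W s t * L j (s j) t.
have G_flip j s : D / 2 <= G j s + G j (flip j s).
  apply: (@le_trans _ _ (D * (1 / 2))); first by lra.
  apply: le_trans (ler_wpM2l D0 (@cube_affinity n j s xn)) _.
  rewrite /G -big_split mulr_sumr /=; apply: ler_sum => t _.
  rewrite ffunE eqxx addTb.
  have : D <= L j (s j) t + L j (~~ s j) t.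
    by case: (s j) => //=; rewrite addrC.
  have := L0 j (s j) t; have := L0 j (~~ s j) t.
  have := W0 s t; have := W0 (flip j s) t.
  rewrite -/(W s t) -/(W (flip j s) t).
  move: (W s t) (W _ t) (L _ _ _) (L _ _ _) => a b l1 l2 a0 b0 l10 l20 Dl.
  rewrite /Num.min; case: ltP => ab; nra.
pose N : R := #|{ffun 'I_m -> bool}|%:R.
have N0 : 0 < N by rewrite ltr0n card_ffun card_bool card_ord expn_gt0.
have sumG j : N * (D / 4) <= \sum_s G j s.
  suff : N * (D / 2) <= \sum_s G j s + \sum_s G j s by lra.
  (* [flip j] is an involution, so the flipped sum equals the original one. *)
  rewrite [X in _ <= _ + X](reindex_inj (inv_inj (flipK j))) -big_split /=.
  rewrite mulr_natl -sumr_const; apply: ler_sum => s _; exact: G_flip.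
apply: contrapT => /forallNP noS.
have lts (s : {ffun 'I_m -> bool}) : (\sum_j G j s) / m%:R < D / 4.
  rewrite ltNge; apply/negP => le_s; apply: (noS s).
  apply: le_trans le_s _; rewrite /G exchange_big mulr_suml /=.
  by apply: ler_sum => t _; rewrite -mulr_sumr mulrA.
have : \sum_s (\sum_j G j s) / m%:R < \sum_(s : {ffun 'I_m -> bool}) D / 4.
  apply: ltr_sum => [|s _]; last exact: lts.
  by apply/hasP; exists [ffun=> true]; rewrite ?mem_index_enum.
have sumN : \sum_(s : {ffun 'I_m -> bool}) D / 4 = N * (D / 4).
  by rewrite sumr_const -[LHS]mulr_natl.
apply/negP; rewrite -leNgt sumN -mulr_suml exchange_big /=.
rewrite ler_pdivlMr ?ltr0n // [leLHS]mulr_natr.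
by rewrite -[X in _ *+ X]card_ord -sumr_const; apply: ler_sum => j _.
Qed.

End cube.

(** * Risk at one noisy point *)

Section bayes.
Context {R : realType}.
Implicit Types a p q x y : R.

(** Bernoulli's inequality, from Young's inequality for [a] and [1] with exponent [p] and its
    conjugate; [p = 1] is separate because its conjugate is infinite. *)
Lemma powR_ge_affine a p : 0 <= a -> 1 <= p -> 1 + p * (a - 1) <= a `^ p.
Proof.
move=> a0; rewrite le_eqVlt => /predU1P[<-|p1]; first by rewrite powRr1 //; lra.
have p0 : 0 < p by lra.
have q0 : 0 < 1 - p^-1 by rewrite subr_gt0 invf_lt1.
have := @conjugate_powR _ a 1 p (1 - p^-1)^-1 a0 ler01 p0.
rewrite invr_gt0 invrK powR1 mulr1 mul1r => /(_ q0 (subrKC _ _)).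
rewrite -(ler_pM2l p0) mulrDr mulrCA divff ?gt_eqF // mulr1 mulrBr divff ?gt_eqF //.
lra.
Qed.

Lemma powR_le_affine a r : 0 <= a -> 0 <= r <= 1 -> a `^ r <= 1 + r * (a - 1).
Proof.
move=> a0 /andP[]; rewrite le_eqVlt => /predU1P[<- _|r0 r1].
  by rewrite powRr0 mul0r addr0.
have := @powR_ge_affine (a `^ r) r^-1 (powR_ge0 _ _).
rewrite -powRrM divff ?gt_eqF // powRr1 // invf_ge1 // => /(_ r1).
rewrite -(ler_pM2l r0) mulrDr mulrA divff ?gt_eqF //; lra.
Qed.

(** Conditional risk, divided by [B ^ q], of predicting [y * B] at a point whose label is [B] with
    probability [(1 + x) / 2] and [-B] otherwise, for [y] in [[-1, 1]]. *)
Definition noisy_risk q x y : R :=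
  (1 + x) / 2 * (1 - y) `^ q + (1 - x) / 2 * (1 + y) `^ q.

Lemma noisy_risk_ge0 q x y : 0 <= x <= 1 -> 0 <= noisy_risk q x y.
Proof.
move=> /andP[x0 x1].
by rewrite addr_ge0 // mulr_ge0 ?powR_ge0 // divr_ge0 //; lra.
Qed.

(** The noise cancels: the sum is [(1 - y)]^ q + (1 + y) [^ q], and the linear terms of the two
    affine lower bounds cancel too. *)
Lemma noisy_riskDN q x y : 1 <= q -> -1 <= y <= 1 ->
  2 <= noisy_risk q x y + noisy_risk q x (- y).
Proof.
move=> q1 /andP[y0 y1]; rewrite /noisy_risk opprK.
have := @powR_ge_affine (1 - y) q; have := @powR_ge_affine (1 + y) q.
rewrite !subr_ge0 => /(_ _ q1) h1 /(_ _ q1) h2.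
have := h1 ltac:(lra); have := h2 ltac:(lra); lra.
Qed.

Lemma noisy_risk_third q x : 0 < x <= 1 -> 1 <= q <= 1 + x ->
  noisy_risk q x (1 / 3) <= 1 - q * x / 6.
Proof.
move=> /andP[x0 x1] /andP[q1 qx].
have powR_quadratic y : -1 < y -> (1 + y) `^ q <= (1 + y) * (1 + (q - 1) * y).
  move=> y1; rewrite -mulr_powRB1; [|lra|lra].
  rewrite ler_wpM2l //; first by lra.
  have := @powR_le_affine (1 + y) (q - 1) ltac:(lra) ltac:(lra).
  by rewrite [1 + y - 1]addrC addKr.
have h1 := powR_quadratic (1 / 3) ltac:(lra).
have h2 := powR_quadratic (- (1 / 3)) ltac:(lra).
have h1' := ler_wpM2l (_ : 0 <= (1 - x) / 2) h1.
have h2' := ler_wpM2l (_ : 0 <= (1 + x) / 2) h2.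
have := h1' ltac:(lra); have := h2' ltac:(lra).
rewrite /noisy_risk; nra.
Qed.

(* The excess risk in a cell, averaged over its two signs, is at least
   [(1 - I) / 2]; what a class of predictors with values [h] and [- h] loses
   against the infimum [I] is [noisy_risk q x h - I]. *)
Lemma exists_near_minimizer q x : 0 < x <= 1 -> 1 <= q <= 1 + x ->
  exists I h, [/\ -1 <= h <= 1,
    forall y, -1 <= y <= 1 -> I <= noisy_risk q x y &
    2 * cq q * x <= (1 - I) / 2 - (noisy_risk q x h - I)].
Proof.
move=> /andP[x0 x1] /andP[q1 qx]; rewrite /cq; case: eqVneq => [->|qN1].
  (* For [q = 1] the risk is affine in [y], so the infimum [1 - x] is attained at [1] and the
     constant [1 / 4] is exact. *)
  have risk1 y : -1 <= y <= 1 -> noisy_risk 1 x y = 1 - x * y.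
    by move=> /andP[y0 y1]; rewrite /noisy_risk !powRr1; [field|lra|lra].
  exists (1 - x), 1; split.
  - by lra.
  - by move=> y y1; rewrite risk1 //; nra.
  - by rewrite risk1; lra.
pose E := noisy_risk q x @` [set y | -1 <= y <= 1].
have E0 : lbound E 0.
  by move=> _ [y _ <-]; apply: noisy_risk_ge0; rewrite x1 ltW.
have hE : has_inf E.
  by split; [exists (noisy_risk q x 0), 0 => //=; lra|exists 0].
(* The value at [1 / 3] gives [(1 - I) / 2 >= q * x / 12], and [1 / 12 - 1 / 30 = 1 / 20 = 2 / 40]:
   this tolerance yields the constant [q / 40]. *)
have qx0 : 0 < q * x / 30 by nra.
have [_ [h /= h1 <-] hI] := inf_adherent qx0 hE.
exists (inf E), h; split => // [y y1|].
  by apply: ge_inf; [exists 0|exists y].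
have : inf E <= noisy_risk q x (1 / 3).
  by apply: ge_inf; [exists 0|exists (1 / 3) => //=; lra].
have := @noisy_risk_third q x; rewrite x0 x1 q1 qx => /(_ isT isT); nra.
Qed.

End bayes.

(** * Risks under finite mixtures, and finite classes of predictors *)

Section mixture_risk.
Context {R : realType} {disp : measure_display} {X : measurableType disp}
  {B : {posnum R}}.

Lemma loss_ge0 q (y y' : label B) : 0 <= loss q y y'.
Proof. exact: powR_ge0. Qed.

Lemma measurable_loss d (T : measurableType d) q (u v : T -> label B) :
  measurable_fun setT u -> measurable_fun setT v ->
  measurable_fun setT (fun t => loss q (u t) (v t)).
Proof.
move=> mu mv; rewrite /loss.
apply: (measurableT_comp (measurable_powR q)).
apply: measurableT_comp => //; apply: measurable_funB.
  exact: (measurableT_comp (@measurable_label_val _ B) mu).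
exact: (measurableT_comp (@measurable_label_val _ B) mv).
Qed.

Lemma exists_mixture_risk (C : finType) (pt : C -> X * label B) (w : C -> R)
    (c0 : C) q n :
    (forall c, 0 <= w c) -> \sum_c w c = 1 ->
  exists P : probability (X * label B)%type R,
    (forall g : {mfun X >-> label B}, risk q P g =
      (\sum_c w c * loss q (pt c).2 (g (pt c).1))%:E) /\
    (forall ghat : n.-tuple (X * label B)%type -> {mfun X >-> label B},
      estimator ghat -> expected_risk q P ghat =
        (\sum_(t : n.-tuple C) (\prod_(c <- t) w c) *
          \sum_c w c * loss q (pt c).2 (ghat (map_tuple pt t) (pt c).1))%:E).
Proof.
move=> w0 w1; have [P intP] := exists_finite_mixture _ _ _ _ pt w c0 w0 w1.
have riskE (g : {mfun X >-> label B}) : risk q P g =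
    (\sum_c w c * loss q (pt c).2 (g (pt c).1))%:E.
  rewrite /risk (intP (fun z => loss q z.2 (g z.1))) // => [z|].
    exact: loss_ge0.
  apply: measurable_loss => //.
  exact: (measurableT_comp (@measurable_funPT _ _ _ _ g) measurable_fst).
exists P; split => // ghat mghat; rewrite /expected_risk.
under eq_integral do rewrite riskE.
rewrite (integral_power_probability _ _ _ _ pt w _ w0 intP n
  (fun z => \sum_c w c * loss q (pt c).2 (ghat z (pt c).1))) // => [z|].
  by apply: sumr_ge0 => c _; rewrite mulr_ge0 // loss_ge0.
apply: measurable_sum => c; apply: measurable_funM => //.
apply: measurable_loss => //.
exact: (measurableT_comp mghat (measurable_pair2 (pt c).1)).
Qed.

Lemma contains_points_le m m' : (m' <= m)%N ->
  contains_points X m -> contains_points X m'.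
Proof.
move=> mm' [x xP]; exists (fun i => x (widen_ord mm' i)) => i j ij.
by apply: xP; apply: contra ij => /eqP /(congr1 val) /= ij; apply/eqP/val_inj.
Qed.

(* [E i] contains [x i] and no other [x j]; the function equals [a] on the union
   of the [E i] with [s i] and [b] elsewhere. *)
Lemma exists_mfun_values m (x : 'I_m -> X) (a b : label B) (s : 'I_m -> bool) :
    (forall i j, i != j -> exists A, [/\ measurable A, A (x i) & ~ A (x j)]) ->
  exists g : {mfun X >-> label B}, forall j, g (x j) = if s j then a else b.
Proof.
move=> sep.
have /choice[A AP] (ij : 'I_m * 'I_m) : exists A : set X, measurable A /\
    (ij.1 != ij.2 -> A (x ij.1) /\ ~ A (x ij.2)).
  (* On the diagonal any measurable set will do, since [E i] intersects only over [j != i]. *)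
  have [<-|/sep[A [mA Ai Aj]]] := eqVneq ij.1 ij.2; last by exists A.
  by exists setT.
pose E i := \bigcap_(j in [set j | j != i]) A (i, j).
pose D := \bigcup_(i in [set i | s i]) E i.
have mD : measurable D.
  apply: fin_bigcup_measurable => [|i _]; first exact: finite_finset.
  apply: fin_bigcap_measurable => [|j _]; first exact: finite_finset.
  by have [] := AP (i, j).
pose f y := if `[< D y >] then a else b.
have mf : measurable_fun setT f.
  apply: measurable_fun_ifT => //; apply: (measurable_fun_bool true).
  rewrite setTI [X in measurable X](_ : _ = D) //.
  by apply/seteqP; split => y /=; [move/asboolP|move=> ?; apply/asboolP].
pose g : {mfun X >-> label B} :=
  HB.pack f (isMeasurableFun.Build _ _ _ _ f mf).
exists g => j; rewrite /g /= /f; congr (if _ then a else b).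
apply/asboolP/idP => [[i /= si Eij]|sj].
  have [<-//|ij] := eqVneq i j.
  have [_ /(_ ij)[_ []]] := AP (i, j).
  by apply: Eij; rewrite /= eq_sym.
by exists j => // k /= jk; have [_ /=] := AP (j, k); rewrite eq_sym => /(_ jk)[].
Qed.

Lemma infinite_mfun : infinite_set [set: {mfun X >-> label B}].
Proof.
have B0 : 0 < B%:num by [].
have lab (k : nat) : - B%:num <= B%:num / k.+1%:R <= B%:num.
  rewrite ler_pdivrMr // ler_peMr // ?ler1n // andbT.
  by rewrite (@le_trans _ _ 0) ?oppr_le0 // divr_ge0.
pose c k : {mfun X >-> label B} := 
  cst (exist (fun y => is_true (- B%:num <= y <= B%:num)) _ (lab k) : label B).
have cI : injective c.
  move=> k l /(congr1 (fun g : {mfun X >-> label B} => label_val (g point))).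
  rewrite /c /= /label_val /= => /(mulfI (lt0r_neq0 B0)) /invr_inj /eqP.
  by rewrite eqr_nat eqSS => /eqP.
move=> fin; apply: infinite_nat.
by rewrite -(preimage_setT c); apply: finite_preimage => // k l _ _; exact: cI.
Qed.

End mixture_risk.

Lemma exists_fset_card_extension {K : choiceType} (S : {fset K}) d :
    infinite_set [set: K] -> (#|` S| <= d)%N ->
  exists2 G : {fset K}, (S `<=` G)%fset & #|` G| = d.
Proof.
move=> Kinf /subnKC <-; elim: (d - _)%N => [|k [G SG cG]].
  by exists S; rewrite ?addn0.
have [x xG] : exists x, x \notin G.
  apply: contrapT => /forallNP allG; apply: Kinf.
  rewrite (_ : setT = [set` G]) //; apply/seteqP; split => // x _ /=.
  by apply/negPn/negP; exact: allG.
exists (x |` G)%fset; first by rewrite (fsubset_trans SG) ?fsubsetU1.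
by rewrite cardfsU1 xG cG add1n addnS.
Qed.

Lemma sgn_itv {R : realDomainType} (b : bool) (y : R) :
  -1 <= y <= 1 -> -1 <= (-1) ^+ b * y <= 1.
Proof. by case: b => /andP[? ?]; rewrite ?expr1 ?expr0; apply/andP; split; lra. Qed.

(** The functions chosen for the [2 ^ m] sign patterns may coincide (when [a = b]), so they form a
    set of at most [2 ^ m] elements, which is then enlarged to [d]. *)
Lemma exists_class {R : realType} {disp} {X : measurableType disp} {B : {posnum R}}
    m (a b : label B) (d : nat) :
    (2 ^ m <= d)%N -> contains_points X m ->
  exists (x : 'I_m -> X) (G : {fset {mfun X >-> label B}}), #|` G| = d /\
    forall s : 'I_m -> bool, exists2 g, g \in G &
      forall j, g (x j) = if s j then a else b.
Proof.
move=> md [x sep]; exists x.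
have /choice[g gP] (s : {ffun 'I_m -> bool}) :
    exists g : {mfun X >-> label B}, forall j, g (x j) = if s j then a else b.
  exact: exists_mfun_values.
pose S := [fset f in [seq g s | s <- enum {ffun 'I_m -> bool}]]%fset.
have cS : (#|` S| <= d)%N.
  rewrite card_fseq (leq_trans (size_undup _)) // size_map -cardE.
  by rewrite card_ffun card_bool card_ord.
have [G /fsubsetP SG cG] := exists_fset_card_extension S d infinite_mfun cS.
exists G; split => // s; exists (g (finfun s)).
  by apply: SG; rewrite inE; apply/mapP; exists (finfun s); rewrite ?mem_enum.
by move=> j; rewrite gP ffunE.
Qed.

(** * The minimax lower bound *)

Lemma hypercube_lower_bound (R : realType) (B : {posnum R}) (d n m : nat)
    (q x : R) (disp : measure_display) (X : measurableType disp) :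
    (0 < m)%N -> 0 < x <= 1 -> x ^+ 2 * n%:R / m%:R <= 1 / 4 -> 1 <= q <= 1 + x ->
    (2 ^ m <= d)%N -> contains_points X m ->
  exists G : {fset {mfun X >-> label B}},
    #|` G| = d /\
    forall ghat : n.-tuple (X * label B)%type -> {mfun X >-> label B},
      estimator ghat ->
      exists P : probability (X * label B)%type R,
        ((2 * cq q * B%:num `^ q * x)%:E <=
           expected_risk q P ghat - min_risk q P G)%E.
Proof.
move=> m0 x01 xn qx md hX.
have [I [h [h1 Iinf Ih]]] := exists_near_minimizer q x x01 qx.
have /andP[x0 x1] := x01; have /andP[q1 _] := qx.
have x01' : 0 <= x <= 1 by rewrite x1 ltW.
have B0 : 0 < B%:num :> R by [].
have Bq0 : 0 <= B%:num `^ q by exact: powR_ge0.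
have labP (y : R) : -1 <= y <= 1 -> - B%:num <= y * B%:num <= B%:num.
  by move=> /andP[? ?]; apply/andP; split; nra.
pose lab y (y1 : -1 <= y <= 1) : label B :=
  exist (fun y => is_true (- B%:num <= y <= B%:num)) _ (labP y y1).
have one1 : -1 <= (1 : R) <= 1 by rewrite lexx andbT; lra.
(* [true] encodes the label [-B] and [false] the label [B]. *)
pose endpoint (b : bool) := lab _ (@sgn_itv R b 1 one1).
pose u (y : label B) := label_val y / B%:num.
have u1 y : -1 <= u y <= 1.
  have /andP[y0 y1] := valP y.
  by rewrite ler_pdivlMr // ler_pdivrMr // mul1r mulN1r; exact/andP.
have loss_endpoint b (y : label B) : loss q (endpoint b) y =
    B%:num `^ q * (1 - (-1) ^+ b * u y) `^ q.
  have /andP[? ?] := @sgn_itv R b _ (u1 y).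
  rewrite -powRM; [|by []|lra]; congr (_ `^ q).
  have -> : label_val (endpoint b) = (-1) ^+ b * B%:num.
    by rewrite /label_val /= mulr1.
  rewrite -[RHS]ger0_norm; last by rewrite mulr_ge0 //; lra.
  have -> : label_val y = u y * B%:num by rewrite divfK // gt_eqF.
  rewrite -mulrBl normrM [RHS]normrM mulrC; congr (_ * _).
  case: (b) => /=; last by rewrite expr0 mul1r.
  by rewrite expr1 mulN1r -normrN opprD !opprK.
have [pts [G [cG Gvals]]] := exists_class m
  (lab _ (@sgn_itv R true h h1)) (lab _ (@sgn_itv R false h h1)) d md hX.
exists G; split => // ghat mghat.
pose pt (c : 'I_m * bool) := (pts c.1, endpoint c.2).
pose y t j := u (ghat (map_tuple pt t) (pts j)).
(* Excess over [B ^ q * I] at point [j] when its likelier sign is [b]; nonnegative because [I]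
   bounds the noisy risk from below. *)
pose L j (b : bool) t := B%:num `^ q * (noisy_risk q x ((-1) ^+ b * y t j) - I).
have L0 j b t : 0 <= L j b t.
  by rewrite mulr_ge0 // subr_ge0; apply: Iinf; exact/sgn_itv/u1.
have noisy_h : I <= noisy_risk q x h by exact: Iinf.
have cq0 : 0 <= 2 * cq q * x.
  have : 0 <= cq q by rewrite /cq; case: ifP => _; lra.
  by nra.
have I1 : 0 <= 1 - I by lra.
have D0 : 0 <= 2 * B%:num `^ q * (1 - I) by rewrite !mulr_ge0.
have LD j t : 2 * B%:num `^ q * (1 - I) <= L j true t + L j false t.
  rewrite /L expr1 expr0 mul1r mulN1r.
  by have := noisy_riskDN q x _ q1 (u1 (ghat (map_tuple pt t) (pts j))); nra.
have [s] := assouad _ _ x m0 x01' n L _ xn D0 L0 LD.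
have [P [riskP exriskP]] := exists_mixture_risk _ pt (cube_weight x s)
  (Ordinal m0, true) q n (cube_weight_ge0 _ _ _ x01' s) (sum_cube_weight1 _ _ _ m0 s).
have riskE (v : 'I_m -> label B) :
    \sum_c cube_weight x s c * loss q (endpoint c.2) (v c.1) =
    B%:num `^ q * ((\sum_j noisy_risk q x ((-1) ^+ s j * u (v j))) / m%:R).
  rewrite (sum_cube_weight _ _ _ m0 s (fun c => loss q (endpoint c.2) (v c.1))).
  rewrite mulrA mulr_sumr; congr (_ / _); apply: eq_bigr => j _ /=.
  rewrite !loss_endpoint /noisy_risk.
  have -> : (-1) ^+ (~~ s j) * u (v j) = - ((-1) ^+ s j * u (v j)).
    by case: (s j); rewrite /= ?expr1 ?expr0 ?mulN1r ?mul1r ?opprK.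
  by rewrite opprK; ring.
have m_neq0 : m%:R != 0 :> R by rewrite pnatr_eq0 -lt0n.
have sum_cst (v : R) : (\sum_(j < m) v) / m%:R = v.
  by rewrite sumr_const card_ord -[X in X / _]mulr_natr mulfK.
move=> sL; exists P; rewrite exriskP //.
have [g gG gE] := Gvals s.
(* The member of the class matching [s] predicts [h] times the likelier label at every point. *)
have min_le : (min_risk q P G <= (B%:num `^ q * noisy_risk q x h)%:E)%E.
  rewrite /min_risk; apply: (@bigmin_inf_seq _ _ _ _ _ g xpredT) => //; rewrite riskP /= (riskE (g \o pts)).
  rewrite lee_fin (eq_bigr (fun=> noisy_risk q x h)) ?sum_cst // => j _.
  congr (noisy_risk q x _); rewrite /= gE /u /label_val.
  by case: (s j); rewrite /= mulfK ?gt_eqF // ?expr1 ?expr0 ?mulN1r ?mul1r ?opprK.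
apply: le_trans (leeB (lexx _) min_le); rewrite -EFinB lee_fin.
have sumW : \sum_(t : n.-tuple ('I_m * bool))
    \prod_(c <- t) cube_weight x s c = 1 :> R.
  by rewrite sum_tuple_prod sum_cube_weight1 // expr1n.
have LE t : (\sum_j L j (s j) t) / m%:R =
    \sum_c cube_weight x s c * loss q (pt c).2 (ghat (map_tuple pt t) (pt c).1) -
    B%:num `^ q * I.
  rewrite (riskE (fun j => ghat (map_tuple pt t) (pts j))) /L.
  by rewrite -mulr_sumr sumrB mulrBr !mulrBl -!mulrA sum_cst.
(* Assouad's bound is [B ^ q * (1 - I) / 2]; subtracting [B ^ q * (noisy_risk q x h - I)] leaves
   exactly what [Ih] bounds from below. *)
move: sL; under eq_bigr do rewrite LE mulrBr.
rewrite sumrB -mulr_suml sumW mul1r; nra.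
Qed.

Theorem theorem8p11 (R : realType) (B : {posnum R}) (d n : nat) (q : R)
    (hd : (1 <= d)%N) (hn : (1 <= n)%N)
    (hq : 1 <= q <=
      1 + Num.sqrt (Num.min ((trunc_log 2 d)%:R / (4 * n)%:R) 1))
    (disp : measure_display) (X : measurableType disp)
    (hX : contains_points X (trunc_log 2 d)) :
  exists G : {fset {mfun X >-> label B}},
    #|` G| = d /\
    forall ghat : n.-tuple (X * label B)%type -> {mfun X >-> label B},
      estimator ghat ->
      exists P : probability (X * label B)%type R,
        ((lower_bound q B%:num n #|` G|)%:E <=
           expected_risk q P ghat - min_risk q P G)%E.
Proof.
set m := trunc_log 2 d in hq hX.
have n_gt0 : 0 < n%:R :> R by rewrite ltr0n.
have md : (2 ^ m <= d)%N by exact: trunc_logP.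
have dm : (d < 2 ^ (4 * n + 1))%N = (m <= 4 * n)%N.
  apply/idP/idP => [dn|mn].
    rewrite -(leq_add2r 1) [leqLHS]addn1 -(@ltn_exp2l 2) //.
    exact: leq_ltn_trans md dn.
  by apply: leq_trans (trunc_log_ltn d (ltnSn 1)) _; rewrite addn1 leq_exp2l.
pose x : R := Num.sqrt (Num.min (m%:R / (4 * n)%:R) 1).
rewrite -/x in hq.
(* Both cases of the bound have this form: [sqrt(m / n) = 2 * sqrt(m / 4n)] when [m <= 4n], and
   [x = 1] otherwise. *)
have boundE (G : {fset {mfun X >-> label B}}) : #|` G| = d ->
    lower_bound q B%:num n #|` G| = 2 * cq q * B%:num `^ q * x.
  move=> ->; rewrite /lower_bound dm -/m /x; case: leqP => mn.
    rewrite min_l; last by rewrite ler_pdivrMr ?mul1r ?ler_nat // ltr0n; lia.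
    rewrite (_ : m%:R / n%:R = 2 ^+ 2 * (m%:R / (4 * n)%:R)); last first.
      by rewrite natrM; field; rewrite gt_eqF.
    by rewrite sqrtrM ?sqr_ge0 // sqrtr_sqr ger0_norm //; ring.
  rewrite min_r; last by rewrite ler_pdivlMr ?mul1r ?ler_nat // ?ltr0n; lia.
  by rewrite sqrtr1 mulr1.
(* If [m = 0] then [d = 1] and [x = 0], so the bound is [0]: under a point mass that the single
   predictor fits exactly, the minimal risk is at most [0]. *)
have [m0|m_gt0] := posnP m.
  pose g0 : {mfun X >-> label B} := cst point.
  have card_g0 : #|` [fset g0]%fset| = d.
    rewrite cardfs1; apply/esym/eqP; rewrite eqn_leq hd andbT -ltnS.
    by apply: leq_trans (trunc_log_ltn d (ltnSn 1)) _; rewrite -/m m0.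
  exists [fset g0]%fset; split=> // ghat mghat.
  have [P [riskP exriskP]] := exists_mixture_risk unit
    (fun=> (point, point) : X * label B) (fun=> 1) tt q n
    (fun=> ler01) ltac:(by rewrite big_const card_unit /= addr0).
  exists P; rewrite boundE //.
  have x0 : x = 0 by rewrite /x m0 mul0r min_l ?sqrtr0.
  have q0 : q != 0 by lra.
  rewrite x0 mulr0 -[0%:E]sube0; apply: leeB.
    rewrite exriskP // lee_fin; apply: sumr_ge0 => t _.
    rewrite mulr_ge0 ?prodr_ge0 // sumr_ge0 // => c _.
    by rewrite mulr_ge0 // loss_ge0.
  rewrite /min_risk; apply: (@bigmin_inf_seq _ _ _ _ _ g0 xpredT) => //.
    by rewrite inE.
  rewrite riskP lee_fin big1 // => c _.
  by rewrite /loss /= subrr normr0 powR0 // mulr0.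
(* Capping the number of points at [4n] makes [x ^+ 2 = k / 4n] in both regimes, so the affinity
   condition holds with equality. *)
pose k := minn m (4 * n).
have n4 : 0 < (4 * n)%:R :> R by rewrite ltr0n; lia.
have x2 : x ^+ 2 = k%:R / (4 * n)%:R.
  rewrite sqr_sqrtr; last by rewrite le_min ler01 divr_ge0.
  rewrite /k; case: (leqP m (4 * n)) => mn.
    by rewrite min_l // ler_pdivrMr // mul1r ler_nat.
  by rewrite min_r ?divff ?gt_eqF // ler_pdivlMr // mul1r ler_nat ltnW.
have k0 : (0 < k)%N by rewrite /k; lia.
have x_gt0 : 0 < x by rewrite sqrtr_gt0 lt_min ltr01 divr_gt0 // ltr0n.
have x_le1 : x <= 1 by rewrite -[leRHS]sqrtr1 ler_wsqrtr // ge_min lexx orbT.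
have xk : x ^+ 2 * n%:R / k%:R <= 1 / 4.
  rewrite x2 natrM [leLHS](_ : _ = 1 / 4) //.
  by field; rewrite !gt_eqF // ltr0n.
have kd : (2 ^ k <= d)%N by apply: leq_trans md; rewrite leq_exp2l ?geq_minl.
have x01 : 0 < x <= 1 by rewrite x_gt0.
have [G [cG GP]] := hypercube_lower_bound R B d n k q x disp X k0 x01 xk hq kd
  (contains_points_le _ _ (geq_minl _ _) hX).
by exists G; rewrite boundE.
Qed.
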